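(* For every positive integer $k$ there is a constant $c>0$, depending on $k$ only, such that the following holds: if $K$ is a field of characteristic different from $2$ and $\mathcal{M}$ is a finite set of nonsingular $k\times k$ matrices over $K$, then the number of ordered pairs $(A,B)\in\mathcal{M}\times\mathcal{M}$ such that $\det(A+B)\neq 0$ is at least $c|\mathcal{M}|^2$.
   Context: Pairs are ordered and pairs with $A=B$ are counted. The constant $c$ does not depend on the field $K$ or on the set $\mathcal{M}$. *)

(* Defs.v *)
From HB Require Import structures.
From mathcomp Require Export all_boot all_order all_algebra.
From mathcomp Require Export finmap reals.

Set Implicit Arguments.
Unset Strict Implicit.
Unset Printing Implicit Defensive.

Import GRing.Theory Num.Theory.
Local Open Scope ring_scope.
Local Open Scope fset_scope.

Definition nonsingular_sum_pairs (K : fieldType) (k : nat)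
    (M : {fset 'M[K]_k}) : {fset 'M[K]_k * 'M[K]_k} :=
  [fset AB in M `*` M | \det (AB.1 + AB.2) != 0].

(* Main.v *)
Require Import Defs.
From mathcomp Require Import all_boot all_order all_algebra finmap reals.
From mathcomp Require Import perm zify.

(** Expanding the determinant gives [\det (A + B) = u(A) v(B)] with a row [u(A)]
    and a column [v(B)] of length [k! 2^k], and [\det (A + A) != 0].
    Let [r] bound the dimension of the span of the [u(A)], and choose [B] with
    the least number [d] of partners [A].  The non-partners [A] of [B] satisfy
    [u(A) v(B) = 0], hence span a space of dimension at most [r - 1], since
    [u(B)] is lost.  By induction on [r], as in Turan's theorem, the number of
    nonsingular pairs is at least [d^2 + (N - d)^2 / (r - 1) >= N^2 / r]. *)

Set Implicit Arguments.
Unset Strict Implicit.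
Unset Printing Implicit Defensive.

Import Order.TTheory GRing.Theory Num.Theory.
Local Open Scope ring_scope.
Local Open Scope fset_scope.

(** After multiplication by [r] this reduces to [2 r x y <= (r x) ^ 2 + y ^ 2]; for [r = 0] the
    hypothesis forces [y = 0]. *)
Lemma turan_step (r x y e : nat) : (y ^ 2 <= r * e)%N ->
  ((x + y) ^ 2 <= r.+1 * (x ^ 2 + e))%N.
Proof.
case: r => [|r] y2_le.
  by move: y2_le; rewrite mul0n leqn0 expn_eq0 andbT => /eqP->; lia.
rewrite -(leq_pmul2l (ltn0Sn r)).
have sq_ge0 : (2 * (r.+1 * x * y) <= (r.+1 * x) ^ 2 + y ^ 2)%N.
  exact: (nat_Cauchy (r.+1 * x) y).1.
have := leq_mul (leqnn r.+2) y2_le; nia.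
Qed.

(** Any space [V] containing the rows is allowed, not only their span, so that the induction can
    pass from [V] to its intersection with the kernel of one column. *)
Lemma nonorthogonal_pairs_lower_bound (X : finType) (K : fieldType) (n r : nat)
    (u : X -> 'rV[K]_n) (v : X -> 'cV[K]_n) (V : 'M[K]_n) (S : {set X}) :
  (forall a, a \in S -> (u a <= V)%MS) ->
  (forall a, a \in S -> u a *m v a != 0) -> (\rank V <= r)%N ->
  (#|S| ^ 2 <=
    r * \sum_(b in S) #|[set a in S | u a *m v b != 0]%R|)%N.
Proof.
elim: r V S => [|r IHr] V S uV uv_neq0 rV.
  case: (set_0Vmem S) => [->|[a aS]]; first by rewrite cards0.
  have V0 : V = 0 by apply/eqP; rewrite -mxrank_eq0 -leqn0.
  by have := uv_neq0 a aS; have := uV a aS;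
     rewrite V0 submx0 => /eqP ->; rewrite mul0mx eqxx.
case: (set_0Vmem S) => [->|[a0 a0S]]; first by rewrite cards0.
pose N b := [set a in S | u a *m v b != 0].
have [b bS b_min] := arg_minnP (fun b => #|N b|) a0S.
set S' := S :\: N b; set V' := (V :&: kermx (v b))%MS.
have NS : N b \subset S by apply/subsetP => a; rewrite inE => /andP[].
have S'P a : a \in S' -> a \in S /\ u a *m v b = 0.
  by rewrite !inE negb_and negbK => /andP[/orP[/negPf->//|/eqP->] ->].
have rV' : (\rank V' <= r)%N.
  rewrite -ltnS; apply: leq_trans rV; rewrite ltn_neqAle mxrankS ?capmxSl// andbT.
  (* Equal ranks would give [V <= V'], putting [u b] into the kernel of [v b]. *)
  apply: contra (uv_neq0 b bS) => eq_rank.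
  have sVV' : (V <= V')%MS by rewrite -(mxrank_leqif_sup (capmxSl _ _)).
  by have := submx_trans (uV b bS) sVV'; rewrite sub_capmx => /andP[_ /sub_kermxP ->].
have uV' a : a \in S' -> (u a <= V')%MS.
  by move=> /S'P[aS /sub_kermxP au0]; rewrite sub_capmx uV.
have uv'_neq0 a : a \in S' -> u a *m v a != 0.
  by move=> /S'P[aS _]; apply: uv_neq0.
have /turan_step - /(_ #|N b|) := IHr V' S' uV' uv'_neq0 rV'.
have -> : (#|N b| + #|S'| = #|S|)%N by rewrite -(cardsID (N b) S) (setIidPr NS).
move=> /leq_trans; apply; rewrite leq_mul2l /=.
(* Each index in [N b] has at least [#|N b|] partners by minimality of [b]; for those in [S'] only
   the partners inside [S'] are kept. *)
rewrite [leqRHS](big_setID (N b)) /= (setIidPr NS) leq_add//.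
  rewrite -mulnn -sum_nat_const; apply: leq_sum => c cN.
  exact/b_min/(subsetP NS).
apply: leq_sum => c _; apply/subset_leq_card/subsetP => a.
by rewrite !inE -andbA => /and3P[_ -> ->].
Qed.

Lemma card_nonsingular_sum_pairs (K : fieldType) (k : nat)
    (M : {fset 'M[K]_k}) :
  (\sum_(B : M) #|[set A : M | \det (val A + val B) != 0]%R| <=
    #|` nonsingular_sum_pairs M|)%N.
Proof.
pose P := [set p : M * M | \det (val p.2 + val p.1) != 0].
(* The double sum runs over [B] first, so the coordinates are swapped back. *)
pose f (p : M * M) := (val p.2, val p.1).
have f_inj : injective f by move=> [a b] [c d] [/val_inj -> /val_inj ->].
have -> : (\sum_(B : M) #|[set A : M | \det (val A + val B) != 0]%R| = #|P|)%N.
  under eq_bigr do rewrite -sum1dep_card.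
  by rewrite pair_big_dep /= sum1dep_card.
have <- : #|` f @` P| = #|P| by rewrite card_imfset //= -cardE.
apply/fsubset_leq_card/fsubsetP => q /imfsetP[p /=]; rewrite inE => pP ->.
by rewrite !inE /= !fsvalP.
Qed.

Section DetExpansion.
Variables (K : fieldType) (k : nat).

Let T : finType := ('S_k * {set 'I_k})%type.

Definition det_row (A : 'M[K]_k) : 'rV[K]_#|T| :=
  \row_t let p : T := enum_val t in
    (-1) ^+ p.1 * \prod_(i in p.2) A i (p.1 i).

Definition det_col (B : 'M[K]_k) : 'cV[K]_#|T| :=
  \col_t let p : T := enum_val t in \prod_(i in ~: p.2) B i (p.1 i).

(** In the Leibniz formula each product of sums is distributed over the set [J] of rows whose factor
    comes from [A]; the other factors come from [B]. *)
Lemma det_add (A B : 'M[K]_k) : det_row A *m det_col B = (\det (A + B))%:M.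
Proof.
apply/rowP => j; rewrite ord1 !mxE eqxx mulr1n.
under eq_bigr do rewrite !mxE /=.
rewrite -(big_enum_val (fun p : T => (-1) ^+ p.1 *
  (\prod_(i in p.2) A i (p.1 i)) * \prod_(i in ~: p.2) B i (p.1 i))) /=.
rewrite -(pair_bigA _ (fun (s : 'S_k) (J : {set 'I_k}) => (-1) ^+ s *
  (\prod_(i in J) A i (s i)) * \prod_(i in ~: J) B i (s i))) /=.
apply: eq_bigr => s _; under [in RHS]eq_bigr do rewrite mxE.
rewrite bigA_distr big_distrr /=; apply: eq_bigr => J _.
rewrite -mulrA [in RHS](bigID (mem J)) /=; congr (_ * (_ * _)).
  by apply: eq_bigr => i ->.
by apply: eq_big => [i|i]; rewrite !inE // => /negPf ->.
Qed.
End DetExpansion.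

Theorem theorem1 (R : realType) (k : nat) (k_gt0 : (0 < k)%N) :
  exists c : R, 0 < c /\
    forall (K : fieldType), 2%N \notin [pchar K] ->
    forall M : {fset 'M[K]_k}, (forall A, A \in M -> A \in unitmx) ->
      c * #|` M|%:R ^+ 2 <= #|` nonsingular_sum_pairs M|%:R.
Proof.
pose n := #|{: 'S_k * {set 'I_k}}|.
have n_gt0 : (0 < n)%N by apply/card_gt0P; exists (1%g, set0).
exists n%:R^-1; split=> [|K char2 M Munit]; first by rewrite invr_gt0 ltr0n.
rewrite ler_pdivrMl ?ltr0n// -natrX -natrM ler_nat.
have two_neq0 : 2 != 0 :> K by move: char2; rewrite inE.
have det_neq0 (A B : M) :
  (det_row (val A) *m det_col (val B) != 0) = (\det (val A + val B) != 0).
  by rewrite det_add -scalemx1 scalemx_eq0 negb_or matrix_nonzero1 andbT.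
have diag_neq0 (A : M) :
  A \in [set: M] -> det_row (val A) *m det_col (val A) != 0.
  (* [\det (A + A) = 2 ^ k * \det A], which is where the characteristic enters. *)
  move=> _; rewrite det_neq0 -mulr2n -scaler_nat detZ mulf_neq0 ?expf_neq0//.
  by have := Munit _ (valP A); rewrite unitmxE unitfE.
(* Here [V] is the whole row space, whose rank is at most [n], the number of terms in the
   expansion. *)
have := nonorthogonal_pairs_lower_bound (fun _ _ => submx1 _) diag_neq0
  (rank_leq_row _).
rewrite cardsT -cardfE => /leq_trans; apply.
rewrite leq_mul2l; apply/orP; right.
apply: leq_trans (card_nonsingular_sum_pairs M); rewrite leq_eqVlt; apply/orP; left.
under eq_bigl do rewrite inE; apply/eqP/eq_bigr => B _.
by apply/eq_card => A; rewrite !inE det_neq0.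
Qed.
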